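(* For every integer $m \ge 1$, with $J$, $K$, $N$ and the counting notation $\left|\begin{matrix}A&B\\ C&D\end{matrix}\right|_m$ as defined in the context, we have, modulo 2, $$ \left|\begin{matrix}J&J\\ J&J\end{matrix}\right|_m \equiv 1,\qquad \left|\begin{matrix}J&N\\ J&N\end{matrix}\right|_m \equiv 1,\qquad \left|\begin{matrix}J&N\\ N&N\end{matrix}\right|_m \equiv m, $$ $$ \left|\begin{matrix}K&K\\ K&K\end{matrix}\right|_m \equiv m+1,\qquad \left|\begin{matrix}K&N\\ K&K\end{matrix}\right|_m \equiv m+1,\qquad \left|\begin{matrix}K&N\\ N&K\end{matrix}\right|_m \equiv m+1. $$
   Context: Let $N$ denote the set of non-negative integers. Let $J=\{(2n+1)2^{2k}-1 \mid n,k\in N\}=\{0,2,3,4,6,8,10,11,\ldots\}$ and $K=N\setminus J=\{(2n+1)2^{2k+1}-1\mid n,k\in N\}=\{1,5,7,9,13,17,\ldots\}$. Let $\mathrm{Sym}_m$ be the set of all permutations of $\{0,1,\ldots,m-1\}$. For subsets $A,B,C,D$ of $N$, $\left|\begin{matrix}A&B\\ C&D\end{matrix}\right|_m$ denotes the number of permutations $\sigma\in\mathrm{Sym}_m$ such that $i+\sigma(i)\in A$ if $i,\sigma(i)\in[0,m-2]$; $i+\sigma(i)\in B$ if $i\in[0,m-2]$ and $\sigma(i)=m-1$; $i+\sigma(i)\in C$ if $i=m-1$ and $\sigma(i)\in[0,m-2]$; $i+\sigma(i)\in D$ if $i=\sigma(i)=m-1$. The notation $a\equiv b$ means congruence modulo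 2. *)

(* Defs.v *)
From mathcomp Require Import all_boot all_fingroup.
From mathcomp Require Import boolp classical_sets.

Set Implicit Arguments.
Unset Strict Implicit.
Unset Printing Implicit Defensive.

Local Open Scope classical_set_scope.
Local Open Scope nat_scope.

Definition J : set nat :=
  [set j | exists n k : nat, j = (2 * n + 1) * 2 ^ (2 * k) - 1].

Definition K : set nat := ~` J.

(* For i < m, the condition i \in [0, m - 2] is i < m.-1; this is also correct
   for m = 1, where the interval is empty. *)
Definition block_perm (A B C D : set nat) (m : nat) (s : 'S_m) : Prop :=
  forall i : 'I_m,
  [/\ i < m.-1 -> s i < m.-1 -> A (i + s i),
      i < m.-1 -> s i = m.-1 :> nat -> B (i + s i),
      i = m.-1 :> nat -> s i < m.-1 -> C (i + s i)
    & i = m.-1 :> nat -> s i = m.-1 :> nat -> D (i + s i)].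

(* The number | A B ; C D |_m *)
Definition block_count (A B C D : set nat) (m : nat) : nat :=
  #|[pred s : 'S_m | `[< block_perm A B C D s >]]|.

(* Main.v *)
(* Modulo 2 the counts are determinants over F_2 of Hankel matrices of the
   indicators a of J and c = a + 1 of K, possibly with a last row or column of
   ones; adding such a border to the other columns exchanges a and c. Since
   a(2k) = 1, a(2k+1) = c(k), c(2k) = 0 and c(2k+1) = a(k), listing even indices
   before odd ones makes half of the blocks vanish. Write J_n, K_n for the n x n
   Hankel determinants and L_n for that of J with a last column of ones. Then
     J_{2n} = K_{2n} = J_n^2,  K_{2n+1} = 0,  J_{2n+1} = L_{n+1}^2,
     L_{p+q} = L_p J_q for q <= p <= q + 1,
   hence J_n = L_n = 1 and K_n = n + 1; the remaining counts reduce to these by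
   expanding along the corner entry. *)

Require Import Defs.
From mathcomp Require Import all_boot all_fingroup all_algebra.
From mathcomp Require Import boolp classical_sets.
From mathcomp Require Import zify.

Import GRing.Theory.

Local Open Scope nat_scope.

(** * Membership in [J] by 2-adic valuation, and the indicators over ['F_2] *)

Lemma mem_J j : J j <-> ~~ odd (logn 2 j.+1).
Proof.
split=> [[n [k ->]]|oddj].
  have -> : ((2 * n + 1) * 2 ^ (2 * k) - 1).+1 = (2 * n + 1) * 2 ^ (2 * k).
    by have := expn_gt0 2 (2 * k); nia.
  rewrite lognM ?expn_gt0 ?addn1 // pfactorK // logn_coprime ?mul2n ?odd_double //.
  by rewrite coprime2n /= odd_double.
have [u cu ju] := @pfactor_coprime 2 j.+1 isT isT.
exists u./2, (logn 2 j.+1)./2.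
have uE : 2 * u./2 + 1 = u.
  by rewrite coprime2n in cu; rewrite -[RHS]odd_double_half cu mul2n addnC.
have lE : 2 * (logn 2 j.+1)./2 = logn 2 j.+1.
  by rewrite -[RHS]odd_double_half (negbTE oddj) mul2n.
by rewrite uE lE -ju subn1.
Qed.

Local Open Scope ring_scope.

Definition indJ (n : nat) : 'F_2 := `[< J n >]%:R.
Definition indK (n : nat) : 'F_2 := `[< K n >]%:R.

Lemma addF2 (x : 'F_2) : x + x = 0.
Proof. by apply: val_inj; case: x => [[|[|x]]]. Qed.

Lemma oppF2 (x : 'F_2) : - x = x.
Proof. by apply/eqP; rewrite eq_sym -addr_eq0 addF2. Qed.

Lemma natrF2_eq (m n : nat) : m%:R = n%:R :> 'F_2 -> m = n %[mod 2].
Proof. by move/(congr1 val); rewrite /= !val_Fp_nat. Qed.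

Lemma indJE n : indJ n = indK n + 1.
Proof.
rewrite /indJ /indK /K.
have -> : `[< (~` J)%classic n >] = ~~ `[< J n >] by rewrite -asbool_neg.
by case: asbool => /=; rewrite ?add0r ?addF2.
Qed.

Lemma indKE n : indK n = indJ n + 1.
Proof. by rewrite indJE -addrA addF2 addr0. Qed.

Lemma indJ_double n : indJ n.*2 = 1.
Proof.
rewrite /indJ; case: asboolP => // -[]; apply/mem_J.
by rewrite logn_coprime // coprime2n /= odd_double.
Qed.

Lemma indK_double n : indK n.*2 = 0.
Proof. by rewrite indKE indJ_double addF2. Qed.

(** The successor of [n.*2.+1] is twice [n.+1], so the valuation rises by one and its parity
    flips. *)
Lemma indK_doubleS n : indK n.*2.+1 = indJ n.
Proof.
rewrite /indK /indJ; congr (_ %:R); congr nat_of_bool; apply: asbool_equiv_eq.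
rewrite /K /setC /=; split.
  move=> h; apply/mem_J/negP => o; apply: h; apply/mem_J.
  by rewrite -doubleS -mul2n lognM //= o.
by move/mem_J => h /mem_J; rewrite -doubleS -mul2n lognM //= h.
Qed.

Lemma indJ_doubleS n : indJ n.*2.+1 = indK n.
Proof. by rewrite indJE indK_doubleS indKE. Qed.

(** * Determinants: permuted indices, blocks and borders of ones *)

Lemma det_F2 n (A : 'M['F_2]_n) : \det A = \sum_(s : 'S_n) \prod_i A i (s i).
Proof.
apply: eq_bigr => s _; case: (odd_perm s); last by rewrite mul1r.
by rewrite expr1 oppF2 mul1r.
Qed.

(** Injective self-maps of the index set are permutations and all signs are 1 in ['F_2], so rows and
    columns may be reordered independently. *)
Lemma det_matrix_reindex n (F : nat -> nat -> 'F_2) (f g : nat -> nat) :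
  {in gtn n &, injective f} -> {in gtn n, forall i, f i < n}%N ->
  {in gtn n &, injective g} -> {in gtn n, forall i, g i < n}%N ->
  \det (\matrix_(i < n, j < n) F (f i) (g j)) = \det (\matrix_(i < n, j < n) F i j).
Proof.
have mkperm (h : nat -> nat) : {in gtn n &, injective h} ->
    {in gtn n, forall i, h i < n}%N -> {s : 'S_n | forall i, s i = h i :> nat}.
  move=> injh hlt.
  have inj : injective (fun i : 'I_n => Ordinal (hlt i (ltn_ord i))).
    by move=> i j /(congr1 val) /= /injh ij; apply/val_inj/ij; rewrite inE.
  by exists (perm inj) => i; rewrite permE.
move=> injf flt injg glt.
have [s sE] := mkperm f injf flt; have [t tE] := mkperm g injg glt.
have -> : \matrix_(i < n, j < n) F (f i) (g j) =
    row_perm s (col_perm t (\matrix_(i < n, j < n) F i j)).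
  by apply/matrixP => i j; rewrite !mxE sE tE.
rewrite row_permE col_permE !det_mulmx !det_perm.
have signE b : (-1) ^+ b = 1 :> 'F_2 by rewrite oppF2 expr1n.
by rewrite !signE mul1r mulr1.
Qed.

Lemma matrix_block {R : Type} p1 p2 q1 q2 (F : nat -> nat -> R) :
  \matrix_(i < p1 + p2, j < q1 + q2) F i j =
  block_mx (\matrix_(i, j) F i j) (\matrix_(i, j) F i (q1 + j)%N)
           (\matrix_(i, j) F (p1 + i)%N j) (\matrix_(i, j) F (p1 + i)%N (q1 + j)%N).
Proof.
apply/matrixP => i j; rewrite mxE.
by case: (split_ordP i) => i' ->; case: (split_ordP j) => j' ->;
  rewrite ?(block_mxEul, block_mxEur, block_mxEdl, block_mxEdr) mxE.
Qed.

(** As [q < p], some nonzero row [v] has [v *m B = 0]; padded with zeros it kills the whole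
    matrix. *)
Lemma det_block0 (F : fieldType) p q (B : 'M[F]_(p, q)) (C : 'M_(q, p)) (D : 'M_q) :
  (q < p)%N -> \det (block_mx 0 B C D) = 0.
Proof.
move=> ltqp; apply/eqP/det0P.
have : kermx B != 0.
  by rewrite -mxrank_eq0 mxrank_ker -lt0n subn_gt0 (leq_ltn_trans (rank_leq_col B)).
case/rowV0Pn => v /sub_kermxP vB v0.
exists (row_mx v 0); first by apply: contra v0; rewrite -row_mx0 => /eqP/eq_row_mx[->].
by rewrite mul_row_block !mulmx0 vB !mul0mx !addr0 row_mx0.
Qed.

Lemma mul_const_mx1 {R : comNzRingType} m n (a b : R) :
  (const_mx a : 'M_(m, 1)) *m (const_mx b : 'M_(1, n)) = const_mx (a * b).
Proof. by apply/matrixP => i j; rewrite !mxE big_ord1 !mxE. Qed.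

(** A unitriangular factor on the right adds the last column to all the others. *)
Lemma det_col_ones {R : comNzRingType} n (A : 'M[R]_(n + 1, n)) :
  \det (row_mx (A + const_mx 1) (const_mx 1)) = \det (row_mx A (const_mx 1)).
Proof.
have -> : row_mx (A + const_mx 1) (const_mx 1) =
    row_mx A (const_mx 1) *m block_mx 1%:M 0 (const_mx 1) (1%:M : 'M_1).
  by rewrite mul_row_block !mulmx1 mulmx0 add0r mul_const_mx1 mulr1.
by rewrite det_mulmx det_lblock !det1 !mulr1.
Qed.

(** Subtracting the last column from the others leaves [A] and clears the last row up to its
    corner. *)
Lemma det_border_ones {R : comNzRingType} n (A : 'M[R]_n) :
  \det (block_mx (A + const_mx 1) (const_mx 1) (const_mx 1) (1 : 'M_1)) = \det A.
Proof.
have -> : block_mx (A + const_mx 1) (const_mx 1) (const_mx 1) (1 : 'M_1) =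
    block_mx A (const_mx 1) 0 1%:M *m block_mx 1%:M 0 (const_mx 1) (1%:M : 'M_1).
  by rewrite mulmx_block !mulmx1 !mulmx0 mul_const_mx1 mulr1 mul1mx !add0r.
by rewrite det_mulmx det_lblock det_ublock !det1 !mulr1.
Qed.

(** Linearity in the last row, split as [(v, 1) = (v, 0) + (0, 1)]. *)
Lemma det_corner {R : comNzRingType} n (A : 'M[R]_n) u v :
  \det (block_mx A u v (1 : 'M_1)) = \det (block_mx A u v 0) + \det A.
Proof.
have row'E w b : row' (rshift n ord0) (block_mx A u w (b : 'M_1)) =
    row' (rshift n ord0) (block_mx A u v 1).
  apply/matrixP => i j; rewrite [LHS]mxE [RHS]mxE.
  have := neq_lift (rshift n (ord0 : 'I_1)) i.
  case: (@split_ordP n 1 (lift (rshift n ord0) i)) => i' ->; last by rewrite (ord1 i') eqxx.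
  by rewrite /block_mx !col_mxEu.
rewrite (@determinant_multilinear _ _ _ (block_mx A u v 0)
           (block_mx A u 0 (1 : 'M_1)) (rshift n ord0) 1 1) ?row'E //.
  by rewrite det_ublock det1 mulr1 !mul1r.
rewrite !scale1r; apply/rowP => j; rewrite [LHS]mxE [RHS]mxE ![row _ _ _ _]mxE.
by case: (split_ordP j) => j' ->;
  rewrite ?(block_mxEdl, block_mxEdr) !mxE ?addr0 ?add0r.
Qed.

(** * Hankel matrices of the indicators *)

Definition hankelJ m n : 'M_(m, n) := \matrix_(i, j) indJ (i + j).
Definition hankelK m n : 'M_(m, n) := \matrix_(i, j) indK (i + j).
(** For [f = indJ] this is the matrix of [L_n]. The test on [j] makes the entry a function of two
    naturals, the form in which indices can be permuted. *)
Definition bordered (f : nat -> 'F_2) n : 'M_n :=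
  \matrix_(i, j) (if (j.+1 < n)%N then f (i + j)%N else 1).

Lemma hankelJE m n : hankelJ m n = hankelK m n + const_mx 1.
Proof. by apply/matrixP => i j; rewrite !mxE indJE. Qed.

Lemma hankelKE m n : hankelK m n = hankelJ m n + const_mx 1.
Proof. by apply/matrixP => i j; rewrite !mxE indKE. Qed.

Lemma borderedE f n :
  bordered f (n + 1) = row_mx (\matrix_(i, j) f (i + j)%N) (const_mx 1).
Proof.
apply/matrixP => i j; rewrite mxE.
case: (split_ordP j) => j' ->; rewrite ?(row_mxEl, row_mxEr) !mxE /=.
  by rewrite ifT //; have := ltn_ord j'; lia.
by rewrite ifN //; lia.
Qed.

Lemma det_bordered n : \det (bordered indJ n.+1) = \det (bordered indK n.+1).
Proof.
by rewrite -(addn1 n) !borderedE -[\matrix_(i, j) indJ _]/(hankelJ _ _) hankelJE det_col_ones.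
Qed.

(** * Separating even from odd indices *)

Definition evens_odds p i := if (i < p)%N then i.*2 else (i - p).*2.+1.
Definition odds_evens q j := if (j < q)%N then j.*2.+1 else (j - q).*2.

Lemma evens_oddsl p (i : 'I_p) : evens_odds p i = i.*2.
Proof. by rewrite /evens_odds ltn_ord. Qed.

Lemma evens_oddsr p i : evens_odds p (p + i) = i.*2.+1.
Proof. by rewrite /evens_odds ltnNge leq_addr addKn. Qed.

Lemma odds_evensl q (j : 'I_q) : odds_evens q j = j.*2.+1.
Proof. by rewrite /odds_evens ltn_ord. Qed.

Lemma odds_evensr q j : odds_evens q (q + j) = j.*2.
Proof. by rewrite /odds_evens ltnNge leq_addr addKn. Qed.

(** The bounds say that exactly [p] of the indices below [p + q] are even and [q] odd, so
    [evens_odds p] permutes them. *)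
Lemma det_evens_odds p q (F : nat -> nat -> 'F_2) : (q <= p <= q.+1)%N ->
  \det (\matrix_(i < p + q, j < p + q) F i j) =
  \det (block_mx (\matrix_(i < p, j < p) F i.*2 j.*2) (\matrix_(i, j) F i.*2 j.*2.+1)
                 (\matrix_(i, j) F i.*2.+1 j.*2) (\matrix_(i < q, j < q) F i.*2.+1 j.*2.+1)).
Proof.
move=> /andP[qp pq].
rewrite -(det_matrix_reindex _ F (evens_odds p) (evens_odds p)); first last.
- by move=> i; rewrite !inE /evens_odds; case: ifP; lia.
- by move=> i j; rewrite !inE /evens_odds; repeat case: ifP; lia.
- by move=> i; rewrite !inE /evens_odds; case: ifP; lia.
- by move=> i j; rewrite !inE /evens_odds; repeat case: ifP; lia.
rewrite (matrix_block _ _ _ _ (fun i j => F (evens_odds p i) (evens_odds p j))).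
by congr (\det (block_mx _ _ _ _)); apply/matrixP => i j;
  rewrite !mxE ?evens_oddsl ?evens_oddsr.
Qed.

(** Listing the odd columns first moves the even-even block, where [indK] vanishes, off the
    diagonal. *)
Lemma det_evens_odds_swap n (F : nat -> nat -> 'F_2) :
  \det (\matrix_(i < n + n, j < n + n) F i j) =
  \det (block_mx (\matrix_(i < n, j < n) F i.*2 j.*2.+1) (\matrix_(i, j) F i.*2 j.*2)
                 (\matrix_(i, j) F i.*2.+1 j.*2.+1) (\matrix_(i < n, j < n) F i.*2.+1 j.*2)).
Proof.
rewrite -(det_matrix_reindex _ F (evens_odds n) (odds_evens n)); first last.
- by move=> i; rewrite !inE /odds_evens; case: ifP; lia.
- by move=> i j; rewrite !inE /odds_evens; repeat case: ifP; lia.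
- by move=> i; rewrite !inE /evens_odds; case: ifP; lia.
- by move=> i j; rewrite !inE /evens_odds; repeat case: ifP; lia.
rewrite (matrix_block _ _ _ _ (fun i j => F (evens_odds n i) (odds_evens n j))).
by congr (\det (block_mx _ _ _ _)); apply/matrixP => i j;
  rewrite !mxE ?evens_oddsl ?evens_oddsr ?odds_evensl ?odds_evensr.
Qed.

(** * Recursions for the Hankel determinants *)

Lemma det_hankelK_double n : \det (hankelK (n + n) (n + n)) = \det (hankelJ n n) ^+ 2.
Proof.
rewrite /hankelK (det_evens_odds_swap n (fun i j => indK (i + j))).
rewrite (_ : block_mx _ _ _ _ = block_mx (hankelJ n n) 0 0 (hankelJ n n)) ?det_lblock //.
congr block_mx; apply/matrixP => i j; rewrite !mxE.
- by rewrite addnS -doubleD indK_doubleS.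
- by rewrite -doubleD indK_double.
- by rewrite addSn addnS -doubleD -doubleS indK_double.
- by rewrite addSn -doubleD indK_doubleS.
Qed.

(** The [n.+1] even rows and columns meet in zeros, leaving only [n] columns for [n.+1] independent
    rows. *)
Lemma det_hankelK_odd n : \det (hankelK (n.+1 + n) (n.+1 + n)) = 0.
Proof.
rewrite /hankelK (det_evens_odds n.+1 n (fun i j => indK (i + j))); last by lia.
rewrite [X in block_mx X _ _ _](_ : _ = 0) ?det_block0 //.
by apply/matrixP => i j; rewrite !mxE -doubleD indK_double.
Qed.

Lemma det_hankelJ_double n : \det (hankelJ (n + n) (n + n)) = \det (hankelJ n n) ^+ 2.
Proof.
rewrite {1}/hankelJ (det_evens_odds_swap n (fun i j => indJ (i + j))).
(* [[1 + J, 1], [1, 1 + J]] = U [[J, 0], [1, J]] U with U unitriangular. *)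
set U : 'M_(n + n) := block_mx 1%:M 1%:M 0 (1%:M : 'M['F_2]_n).
rewrite (_ : block_mx _ _ _ _ =
    U *m block_mx (hankelJ n n) 0 (const_mx 1) (hankelJ n n) *m U); last first.
  rewrite !mulmx_block !mulmx0 !mulmx1 !mul1mx !mul0mx !addr0 !add0r.
  congr block_mx; apply/matrixP => i j; rewrite !mxE.
  - by rewrite addnS -doubleD indJ_doubleS indKE.
  - by rewrite -doubleD indJ_double addrAC addF2 add0r.
  - by rewrite addSn addnS -doubleD -doubleS indJ_double.
  - by rewrite addSn -doubleD indJ_doubleS indKE addrC.
by rewrite !det_mulmx det_ublock det_lblock !det1 !mul1r mulr1.
Qed.

Lemma bordered_hankelK m : block_mx (hankelK m m) (const_mx 1) (const_mx 1) (1 : 'M_1) =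
  \matrix_(i < m + 1, j < m + 1) (if (i < m)%N && (j < m)%N then indK (i + j) else 1).
Proof.
rewrite (matrix_block _ _ _ _ (fun i j => if (i < m)%N && (j < m)%N then indK (i + j) else 1)).
congr block_mx; apply/matrixP => i j; rewrite !mxE ?ltn_ord //=.
- by rewrite ltnNge leq_addr.
- by rewrite ltnNge leq_addr.
- by rewrite !ord1 ltnNge leq_addr.
Qed.

(* The border has index 2n+1, so it joins the odd indices and its corner entry
   falls in the irrelevant block. *)
Lemma det_hankelJ_odd n :
  \det (hankelJ (n.+1 + n) (n.+1 + n)) = \det (bordered indJ n.+1) ^+ 2.
Proof.
(* A border of ones turns [indJ] into [indK] and makes the size even, [n.+1 + n.+1]. *)
rewrite -det_border_ones -hankelKE bordered_hankelK addn1 -addnS.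
rewrite (det_evens_odds_swap n.+1
  (fun i j => if (i < n.+1 + n)%N && (j < n.+1 + n)%N then indK (i + j) else 1)).
rewrite [X in block_mx X _ _ _](_ : _ = bordered indJ n.+1); last first.
  apply/matrixP => i j; rewrite !mxE.
  rewrite (_ : (_ && _) = (j.+1 < n.+1)%N); last by have := ltn_ord i; lia.
  by rewrite addnS -doubleD indK_doubleS.
rewrite [X in block_mx _ X _ _](_ : _ = 0); last first.
  apply/matrixP => i j; rewrite !mxE ifT; last by have := ltn_ord i; have := ltn_ord j; lia.
  by rewrite -doubleD indK_double.
rewrite [X in block_mx _ _ _ X](_ : _ = (bordered indJ n.+1)^T).
  by rewrite det_lblock det_tr.
apply/matrixP => i j; rewrite !mxE.
rewrite (_ : (_ && _) = (i.+1 < n.+1)%N); last by have := ltn_ord j; lia.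
by rewrite addSn -doubleD indK_doubleS addnC.
Qed.

(* The even rows meet the even columns in zeros, so the border column is listed
   with the odd ones to get a block triangular matrix. *)
Lemma det_bordered_split p q : (q <= p.+1 <= q.+1)%N ->
  \det (bordered indJ (p.+1 + q)) = \det (bordered indJ p.+1) * \det (hankelJ q q).
Proof.
move=> /andP[qp pq]; rewrite addSn det_bordered /bordered -addSn.
pose F i j := if (j.+1 < p.+1 + q)%N then indK (i + j) else 1.
(* Position [p] receives the border column [p + q], which is [p.*2] or [p.*2.+1] because [q] is [p]
   or [p.+1]. *)
pose g j := if j == p then (p + q)%N else odds_evens p.+1 j.
rewrite -(det_matrix_reindex _ F (evens_odds p.+1) g); first last.
- by move=> i; rewrite !inE /g /odds_evens; repeat case: ifP; lia.
- by move=> i j; rewrite !inE /g /odds_evens; repeat case: ifP; lia.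
- by move=> i; rewrite !inE /evens_odds; case: ifP; lia.
- by move=> i j; rewrite !inE /evens_odds; repeat case: ifP; lia.
rewrite (matrix_block _ _ _ _ (fun i j => F (evens_odds p.+1 i) (g j))).
have gr j : g (p.+1 + j)%N = j.*2 by rewrite /g ifN ?odds_evensr //; lia.
rewrite [X in block_mx X _ _ _](_ : _ = bordered indJ p.+1); last first.
  apply/matrixP => i j; rewrite !mxE /F /g evens_oddsl odds_evensl.
  have := ltn_ord j; case: eqP => [-> _|jp ltj].
    by rewrite ltnn addSn ltnn.
  rewrite !ifT; [|lia..].
  by rewrite addnS -doubleD indK_doubleS.
rewrite [X in block_mx _ X _ _](_ : _ = 0); last first.
  apply/matrixP => i j; rewrite !mxE /F gr evens_oddsl ifT; last by have := ltn_ord j; lia.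
  by rewrite -doubleD indK_double.
rewrite [X in block_mx _ _ _ X](_ : _ = hankelJ q q) ?det_lblock //.
apply/matrixP => i j; rewrite !mxE /F gr evens_oddsr ifT; last by have := ltn_ord j; lia.
by rewrite addSn -doubleD indK_doubleS.
Qed.

(** * Values of the determinants *)

Lemma double_or_odd n : n = (n./2 + n./2)%N \/ n = ((n./2).+1 + n./2)%N.
Proof. lia. Qed.

(** The two claims need a joint strong induction: odd sizes of [hankelJ] call for [bordered], which
    in turn splits off a [hankelJ]. *)
Lemma det_hankelJ_bordered n :
  \det (hankelJ n n) = 1 /\ \det (bordered indJ n.+1) = 1.
Proof.
elim/ltn_ind: n => n IH.
have detJ : \det (hankelJ n n) = 1.
  case: (posnP n) => [->|n0]; first by rewrite det_mx00.
  have [IHJ IHL] : \det (hankelJ n./2 n./2) = 1 /\ \det (bordered indJ (n./2).+1) = 1.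
    by apply: IH; lia.
  have [->|->] := double_or_odd n.
    by rewrite det_hankelJ_double IHJ expr1n.
  by rewrite det_hankelJ_odd IHL expr1n.
split=> //; case: (posnP n) => [->|n0].
  by rewrite (det_mx11 (bordered indJ 1)) mxE.
have -> : n.+1 = ((n./2).+1 + (n.+1)./2)%N by lia.
rewrite det_bordered_split; last by lia.
have [|_ ->] := IH n./2; first by lia.
(* The half [n.+1./2] is below [n] except for [n = 1], where [detJ] replaces the induction
   hypothesis. *)
have [/IH[-> _]|nle] := ltnP n.+1./2 n; first exact: mul1r.
by rewrite (_ : n.+1./2 = n) ?detJ ?mul1r //; lia.
Qed.

Lemma det_hankelJ n : \det (hankelJ n n) = 1.
Proof. by have [] := det_hankelJ_bordered n. Qed.

Lemma det_borderedJ n : \det (bordered indJ n.+1) = 1.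
Proof. by have [] := det_hankelJ_bordered n. Qed.

Lemma natr_odd n : n%:R = (odd n)%:R :> 'F_2.
Proof. by apply: val_inj; rewrite /= !val_Fp_nat // !modn2; case: odd. Qed.

Lemma det_hankelK n : \det (hankelK n n) = n.+1%:R.
Proof.
have [->|->] := double_or_odd n.
  by rewrite det_hankelK_double det_hankelJ expr1n natr_odd addnn /= odd_double.
by rewrite det_hankelK_odd natr_odd addSn addnn /= odd_double.
Qed.

(** With corner 1 the determinant is that of [hankelJ], namely 1; changing the corner to 0 subtracts
    [n.+1%:R]. *)
Lemma det_hankelK_border n :
  \det (block_mx (hankelK n n) (const_mx 1) (const_mx 1) (0 : 'M_1)) = n%:R.
Proof.
have := det_corner _ (hankelK n n) (const_mx 1) (const_mx 1).
rewrite {1}hankelKE det_border_ones det_hankelJ det_hankelK => /eqP.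
by rewrite -subr_eq oppF2 -natr1 addrCA addF2 addr0 => /eqP ->.
Qed.

(** * From counts to determinants *)

Definition entry (A B C D : set nat) n i j : Prop :=
  if (i < n)%N then (if (j < n)%N then A (i + j)%N else B (i + j)%N)
  else (if (j < n)%N then C (i + j)%N else D (i + j)%N).

(** A product of 0-1 entries along [s] is 1 exactly when [s] is admissible, and modulo 2 the
    permanent is the determinant. *)
Lemma block_count_det A B C D n : (block_count A B C D (n + 1))%:R =
  \det (\matrix_(i < n + 1, j < n + 1) (`[< entry A B C D n i j >]%:R : 'F_2)).
Proof.
have predE : (n + 1).-1 = n by rewrite addn1.
rewrite det_F2 /block_count -sum1_card natr_sum big_mkcond /=.
apply: eq_bigr => s _; rewrite inE.
under eq_bigr do rewrite mxE.
have -> : `[< block_perm A B C D s >] = [forall i : 'I_(n + 1), `[< entry A B C D n i (s i) >]].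
  apply/asboolP/forallP => [h i|h i].
    have := h i; rewrite predE => -[hA hB hC hD]; apply/asboolP; rewrite /entry.
    have li := ltn_ord i; have ls := ltn_ord (s i).
    case: ltnP => hi; case: ltnP => hs.
    - exact: hA.
    - by apply: hB => //; lia.
    - by apply: hC => //; lia.
    - by apply: hD; lia.
  have /asboolP := h i; rewrite /entry predE => hi.
  by split=> i_n s_n; move: hi; rewrite ?i_n ?s_n ?ltnn.
case: forallP => [h|/forallP]; first by rewrite big1 // => i _; rewrite h.
by rewrite negb_forall => /existsP[i /negbTE hi]; rewrite (bigD1 i) //= hi mul0r.
Qed.

Lemma block_count_block (A B C D : set nat) n : (block_count A B C D (n + 1))%:R =
  \det (block_mx (\matrix_(i < n, j < n) `[< A (i + j)%N >]%:R)
                 (\matrix_(i < n, j < 1) `[< B (i + (n + j))%N >]%:R)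
                 (\matrix_(i < 1, j < n) `[< C (n + i + j)%N >]%:R)
                 (\matrix_(i < 1, j < 1) (`[< D (n + i + (n + j))%N >]%:R : 'F_2))).
Proof.
rewrite block_count_det (matrix_block _ _ _ _ (fun i j => `[< entry A B C D n i j >]%:R)).
congr (\det (block_mx _ _ _ _)); apply/matrixP => i j; rewrite !mxE /entry;
  by rewrite ?ltn_ord ?[(n + _ < n)%N]ltnNge ?leq_addr /=.
Qed.

Local Close Scope ring_scope.

Theorem theoremD (m : nat) (hm : 1 <= m) :
  (block_count J J J J m = 1 %[mod 2]) /\
  (block_count J setT J setT m = 1 %[mod 2]) /\
  (block_count J setT setT setT m = m %[mod 2]) /\
  (block_count K K K K m = m + 1 %[mod 2]) /\
  (block_count K setT K K m = m + 1 %[mod 2]) /\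
  (block_count K setT setT K m = m + 1 %[mod 2]).
Proof.
case: m hm => // n _; rewrite -(addn1 n).
have inT (x : nat) : `[< (setT : set nat) x >] = true by apply/asboolP.
(* The corner sum is even, and [K] has no even member. *)
have inK x : `[< K (n + x + (n + x)) >] = false.
  by have := indK_double (n + x); rewrite /indK -addnn; case: asbool.
have cornerK u v : (\det (block_mx (hankelK n n) u v (0 : 'M_1)) =
    \det (block_mx (hankelK n n) u v (1 : 'M_1)) + n.+1%:R)%R.
  by rewrite det_corner det_hankelK -addrA addF2 addr0.
do ![split]; apply: natrF2_eq.
- rewrite block_count_det -[RHS](det_hankelJ (n + 1)); congr (\det _)%R.
  by apply/matrixP => i j; rewrite !mxE /entry !if_same.
- rewrite block_count_det -[RHS](det_borderedJ n) -(addn1 n); congr (\det _)%R.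
  apply/matrixP => i j; rewrite !mxE /entry !if_same.
  by rewrite (_ : (j.+1 < n + 1) = (j < n)); [case: ifP; rewrite ?inT|lia].
(* Removing the border of ones turns [indJ] into [indK] at size [n]. *)
- rewrite block_count_block [in RHS]addn1 -det_hankelK -[RHS]det_border_ones -hankelJE.
  by congr (\det (block_mx _ _ _ _))%R; apply/matrixP => i j; rewrite !mxE ?inT ?ord1.
- rewrite block_count_det [in RHS]addn1 -det_hankelK; congr (\det _)%R.
  by apply/matrixP => i j; rewrite !mxE /entry !if_same.
(* Raising the corner from 0 to 1 costs [n.+1%:R] and completes the last column of ones, giving
   [bordered indK], of determinant 1. *)
- pose v : 'M['F_2]_(1, n) := (\matrix_(i, j) indK (n + i + j))%R.
  transitivity (\det (block_mx (hankelK n n) (const_mx 1) v (0 : 'M_1)))%R.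
    rewrite block_count_block.
    by congr (\det (block_mx _ _ _ _))%R; apply/matrixP => i j; rewrite !mxE ?inT ?ord1 ?inK.
  rewrite cornerK [in RHS]addn1 -[in RHS]natr1 [in RHS]addn1 addrC; congr (_ + _)%R.
  rewrite -[RHS](det_borderedJ n) det_bordered -(addn1 n) /bordered.
  rewrite (matrix_block _ _ _ _ (fun i j => if j.+1 < n + 1 then indK (i + j) else 1%R)).
  congr (\det (block_mx _ _ _ _))%R; apply/matrixP => i j; rewrite !mxE.
  - by rewrite ifT //; have := ltn_ord j; lia.
  - by rewrite ifN //; lia.
  - by rewrite ifT //; have := ltn_ord j; lia.
  - by rewrite ifN; [rewrite !ord1|lia].
- transitivity (\det (block_mx (hankelK n n) (const_mx 1) (const_mx 1) (0 : 'M_1)))%R.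
    rewrite block_count_block.
    by congr (\det (block_mx _ _ _ _))%R; apply/matrixP => i j; rewrite !mxE ?inT ?ord1 ?inK.
  by rewrite det_hankelK_border (natr_odd n) (natr_odd (n + 1 + 1)) -addnA oddD addbF.
Qed.
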